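(* Let $n\ge 2$, let $\mathcal{O}_i=\mathcal{E}_\le(c_i,E_i)\subset\mathbb{R}^n$, $i\in\mathbb{I}=\{1,\dots,I\}$, be pairwise disjoint ellipsoidal obstacles with $\|E_ic_i\|>1$ for all $i\in\mathbb{I}$. Let $k_0>0$, $\epsilon\in(0,1)$ and $\mathcal{W}_\epsilon:=\bigcap_{i\in\mathbb{I}}\mathcal{E}_\ge(c_i,\epsilon E_i)$. Then there exist controller parameters (in the admissible ranges given in the context, with this $k_0$) such that the hybrid control law matches, in $\mathcal{W}_\epsilon$, the stabilization feedback $u=-k_0x$ used in the absence of obstacles; that is, $\kappa(x,i,m)=-k_0x$ for every $(x,i,m)\in\mathcal{F}$ with $x\in\mathcal{W}_\epsilon$, where $\mathcal{F}$ is the flow set and $\kappa$ the control law of the hybrid controller described in the context.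
   Context: **Geometry.** ''Positive definite'' means symmetric positive definite. For $c\in\mathbb{R}^n$ and $E\in\mathbb{R}^{n\times n}$ positive definite, $\mathcal{E}(c,E)=\{x\in\mathbb{R}^n:\|E(x-c)\|^2=1\}$; $\mathcal{E}_\le(c,E)$, $\mathcal{E}_\ge(c,E)$ are obtained by replacing $=$ with $\le$, $\ge$. For $v\in\mathbb{R}^n\setminus\{0\}$ and $\theta\in[0,\pi/2]$, $\mathcal{C}(c,v,\theta,E)=\{x\in\mathbb{R}^n:\cos(\theta)\|Ev\|\,\|E(x-c)\|=v^\top E^2(x-c)\}$; $\mathcal{C}_\ge$ is obtained by replacing $=$ with $\ge$. For $z\in\mathbb{R}^n\setminus\{0\}$: $\pi^\perp(z)=I_n-zz^\top/\|z\|^2$, $\rho(z)=I_n-2zz^\top/\|z\|^2$. **Obstacles.** $I\in\mathbb{N}$, $\mathbb{I}=\{1,\dots,I\}$, $c_i\in\mathbb{R}^n$, $E_i\in\mathbb{R}^{n\times n}$ positive definite, $\mathcal{W}=\bigcap_{i\in\mathbb{I}}\mathcal{E}_\ge(c_i,E_i)$, $\mathbb{M}=\{-1,0,1\}$, $\bar c_i=c_i/2$, $\bar E_i=2E_i/\|E_ic_i\|$. **Parameters (admissible ranges).** With $\underline\delta_i=\|E_ic_i\|^{-1/2}$, $\bar\mu_i(\delta_i)=\big(1-4\underline\delta_i^2(1-\underline\delta_i^2/\delta_i^2)\big)^{-1/2}$, $\bar\theta_i(\delta_i,\mu_i)=\arccos\big(\tfrac{\underline\delta_i^2}{\delta_i^2}+\tfrac{1}{4\underline\delta_i^2}(1-\tfrac1{\mu_i^2})\big)$,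 for each $i\in\mathbb{I}$: $\delta_i\in(\underline\delta_i,1)$, $\epsilon_i\in(\delta_i,1)$, $\mu_i\in(1,\bar\mu_i(\delta_i))$, $\nu_i\in(1,\mu_i)$, $\theta_i\in(0,\bar\theta_i(\delta_i,\mu_i))$, $\bar\psi_i\in(0,\theta_i)$, $\psi_i\in(0,\bar\psi_i)$; $k_{-1},k_0,k_1>0$; $p_1^i\in\mathcal{C}(c_i,-c_i,\theta_i,E_i)\setminus\{c_i\}$ and $p_{-1}^i=-E_i^{-1}\rho(E_ic_i)E_ip_1^i$. **Control.** The vehicle is $\dot x=u$, $u=\kappa(x,i,m)$, with $\kappa(x,i,0)=-k_0x$ and, for $m\in\{-1,1\}$, $\kappa(x,i,m)=-k_mE_i^{-1}\pi^\perp(E_i(x-c_i))E_i(x-p_m^i)$. The discrete variables $i\in\mathbb{I}$, $m\in\mathbb{M}$ are constant during flow, and the closed loop is allowed to flow only when $(x,i,m)\in\mathcal{F}$. **Flow set.** $\mathcal{H}_i(\delta,\mu)=\mathcal{E}_\le(c_i,\delta E_i)\cap\mathcal{E}_\ge(c_i,E_i)\cap\mathcal{E}_\ge(\bar c_i,\mu\bar E_i)$; $\mathcal{F}_0^i=(\mathcal{E}_\ge(c_i,\epsilon_iE_i)\cup\mathcal{E}_\le(\bar c_i,\nu_i\bar E_i))\cap\mathcal{W}$; $\mathcal{F}_0=(\bigcap_{i\in\mathbb{I}}\mathcal{F}_0^i)\times\mathbb{I}$; for $m\in\{-1,1\}$, $\mathcal{F}_m^i=\mathcal{H}_i(\delta_i,\mu_i)\cap\mathcal{C}_\ge(c_i,c_i-p_m^i,\psi_i,E_i)\cap\mathcal{W}$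 and $\mathcal{F}_m=\bigcup_{i\in\mathbb{I}}(\mathcal{F}_m^i\times\{i\})$; $\mathcal{F}=\bigcup_{m\in\mathbb{M}}(\mathcal{F}_m\times\{m\})$. *)

(* Defs.v *)
From HB Require Import structures.
From mathcomp Require Import all_boot all_order all_algebra.
From mathcomp Require Import all_classical all_reals all_analysis.

Set Implicit Arguments.
Unset Strict Implicit.
Unset Printing Implicit Defensive.

Import Order.TTheory GRing.Theory Num.Theory.

Local Open Scope classical_set_scope.
Local Open Scope ring_scope.

Section Geometry.
Context {R : realType} {n : nat}.
Implicit Types (c v x z : 'cV[R]_n) (E : 'M[R]_n) (theta : R).

(* The library norm `|x| on matrices is the sup norm, hence this definition. *)
Definition enorm x : R := Num.sqrt (\sum_i x i 0 ^+ 2).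

Definition posdefmx E : Prop :=
  E^T = E /\ forall x, x != 0 -> 0 < (x^T *m E *m x) 0 0.

Definition ellipsoid_le c E : set 'cV[R]_n :=
  [set x | enorm (E *m (x - c)) ^+ 2 <= 1].

Definition ellipsoid_ge c E : set 'cV[R]_n :=
  [set x | 1 <= enorm (E *m (x - c)) ^+ 2].

Definition cone c v theta E : set 'cV[R]_n :=
  [set x | cos theta * enorm (E *m v) * enorm (E *m (x - c))
           = (v^T *m (E *m E) *m (x - c)) 0 0].

(* The inequality reads lhs >= rhs: this is the region outside the cone. *)
Definition cone_ge c v theta E : set 'cV[R]_n :=
  [set x | (v^T *m (E *m E) *m (x - c)) 0 0
           <= cos theta * enorm (E *m v) * enorm (E *m (x - c))].

Definition pi_perp z : 'M[R]_n := 1%:M - (enorm z ^+ 2)^-1 *: (z *m z^T).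

Definition rho z : 'M[R]_n := 1%:M - (2 / enorm z ^+ 2) *: (z *m z^T).

End Geometry.

(* The logic variable m in {-1, 0, 1}. *)
Inductive mode := mode_m1 | mode_0 | mode_1.

Record controller_params (R : realType) (n I : nat) := ControllerParams {
  gain_m1 : R;
  gain_0 : R;
  gain_1 : R;
  delta : 'I_I -> R;
  epsilon : 'I_I -> R;
  mu : 'I_I -> R;
  nu : 'I_I -> R;
  theta : 'I_I -> R;
  psibar : 'I_I -> R;
  psi : 'I_I -> R;
  p1 : 'I_I -> 'cV[R]_n
}.

Section Controller.
Context {R : realType} {n I : nat}.
Variables (c : 'I_I -> 'cV[R]_n) (E : 'I_I -> 'M[R]_n).
Implicit Types (i : 'I_I) (m : mode) (x : 'cV[R]_n).

Definition obstacle i : set 'cV[R]_n := ellipsoid_le (c i) (E i).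

Definition free_space : set 'cV[R]_n :=
  \bigcap_(i in [set: 'I_I]) ellipsoid_ge (c i) (E i).

(* For 0 < eps < 1 this keeps x outside of obstacles dilated by 1 / eps. *)
Definition shrunk_free_space (eps : R) : set 'cV[R]_n :=
  \bigcap_(i in [set: 'I_I]) ellipsoid_ge (c i) (eps *: E i).

Definition cbar i : 'cV[R]_n := 2^-1 *: c i.

Definition Ebar i : 'M[R]_n := (2 / enorm (E i *m c i)) *: E i.

Definition delta_low i : R := enorm (E i *m c i) `^ (- 2^-1).

Definition mu_up i (d : R) : R :=
  (1 - 4 * delta_low i ^+ 2 * (1 - delta_low i ^+ 2 / d ^+ 2)) `^ (- 2^-1).

Definition theta_up i (d m : R) : R :=
  acos (delta_low i ^+ 2 / d ^+ 2
        + (4 * delta_low i ^+ 2)^-1 * (1 - (m ^+ 2)^-1)).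

Variable P : controller_params R n I.

Definition pm1 i : 'cV[R]_n :=
  - (invmx (E i) *m rho (E i *m c i) *m E i *m p1 P i).

Definition admissible : Prop :=
  [/\ 0 < gain_m1 P, 0 < gain_0 P, 0 < gain_1 P
    & forall i,
      [/\ delta P i \in `]delta_low i, 1[,
          epsilon P i \in `]delta P i, 1[,
          mu P i \in `]1, mu_up i (delta P i)[
        & nu P i \in `]1, mu P i[ ] /\
      [/\ theta P i \in `]0, theta_up i (delta P i) (mu P i)[,
          psibar P i \in `]0, theta P i[,
          psi P i \in `]0, psibar P i[
        & (cone (c i) (- c i) (theta P i) (E i) `\ c i) (p1 P i)]].

Definition avoidance (k : R) (p : 'cV[R]_n) i x : 'cV[R]_n :=
  - (k *: (invmx (E i) *m pi_perp (E i *m (x - c i)) *m E i *m (x - p))).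

Definition kappa x i m : 'cV[R]_n :=
  match m with
  | mode_m1 => avoidance (gain_m1 P) (pm1 i) i x
  | mode_0 => - (gain_0 P *: x)
  | mode_1 => avoidance (gain_1 P) (p1 P i) i x
  end.

Definition helmet i (d m : R) : set 'cV[R]_n :=
  ellipsoid_le (c i) (d *: E i) `&` ellipsoid_ge (c i) (E i)
  `&` ellipsoid_ge (cbar i) (m *: Ebar i).

Definition flow_stab_at i : set 'cV[R]_n :=
  (ellipsoid_ge (c i) (epsilon P i *: E i)
   `|` ellipsoid_le (cbar i) (nu P i *: Ebar i)) `&` free_space.

Definition flow_avoid_at (p : 'cV[R]_n) i : set 'cV[R]_n :=
  helmet i (delta P i) (mu P i)
  `&` cone_ge (c i) (c i - p) (psi P i) (E i) `&` free_space.

Definition flow_mode m : set ('cV[R]_n * 'I_I) :=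
  match m with
  | mode_m1 => \bigcup_(i in [set: 'I_I]) (flow_avoid_at (pm1 i) i `*` [set i])
  | mode_0 => (\bigcap_(i in [set: 'I_I]) flow_stab_at i) `*` [set: 'I_I]
  | mode_1 => \bigcup_(i in [set: 'I_I]) (flow_avoid_at (p1 P i) i `*` [set i])
  end.

Definition flow_set : set ('cV[R]_n * 'I_I * mode) :=
  \bigcup_(m in [set: mode]) (flow_mode m `*` [set m]).

End Controller.

(* Main.v *)
Require Import Defs.
From mathcomp Require Import all_boot all_order all_algebra.
From mathcomp Require Import all_classical all_reals all_analysis.
From mathcomp Require Import ring lra.

Import Order.TTheory GRing.Theory Num.Theory.

Local Open Scope classical_set_scope.
Local Open Scope ring_scope.

(** The avoidance mode of an obstacle is active only inside its helmet, whose
    outer boundary is the obstacle dilated by [1 / delta], whereas a point of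
    the shrunk free space lies outside the obstacle dilated by [1 / eps].  As
    soon as [delta] is larger than [eps] the two regions are disjoint
    ([helmet_shrunk_disjoint]), so that in the shrunk free space the closed
    loop flows only in the stabilization mode, where the control is [- k0 x]
    by definition.

    What remains is that the admissible ranges leave room for such a [delta]
    and are all nonempty, since each upper bound depends on the parameters
    already chosen.  Write [s] for the square of [delta_low] and [t] for the
    square of [delta].  Then [0 < s < 1] because the origin is outside the
    obstacle, and [s < t < 1] gives
    [(1 - 2 s)^2 < 1 - 4 s (1 - s / t) < 1], which makes the upper bound of
    [mu] larger than [1] ([mu_up_gt1]).  The condition on [mu] says precisely
    that the argument of the arccosine defining the upper bound of [theta] is
    less than [1], which makes this bound positive ([theta_up_gt0]).  Finally
    a point [p1] other than the apex exists on the cone because there is a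
    direction orthogonal to its axis in dimension at least two
    ([cone_nonapex]). *)

(** * Euclidean norm and positive definite matrices *)

Section Euclidean.
Context {R : realType} {n : nat}.
Implicit Types (x z w : 'cV[R]_n) (E : 'M[R]_n).

Lemma enorm_sqr x : enorm x ^+ 2 = (x^T *m x) 0 0.
Proof.
rewrite sqr_sqrtr; last by apply: sumr_ge0 => i _; exact: sqr_ge0.
by rewrite mxE; apply: eq_bigr => i _; rewrite mxE expr2.
Qed.

Lemma dotC z w : (z^T *m w) 0 0 = (w^T *m z) 0 0.
Proof. by rewrite -(trmxK (z^T *m w)) mxE trmx_mul trmxK. Qed.

Lemma enorm_ge0 x : 0 <= enorm x. Proof. exact: sqrtr_ge0. Qed.

Lemma enorm_gt0 x : (0 < enorm x) = (x != 0).
Proof.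
rewrite lt_def enorm_ge0 andbT; congr (~~ _).
have sq_ge0 (i : 'I_n) : true -> 0 <= x i 0 ^+ 2 by rewrite sqr_ge0.
rewrite sqrtr_eq0 le_eqVlt ltNge sumr_ge0 // orbF psumr_eq0 //.
apply/allP/eqP => [x0|-> i _]; last by rewrite /= mxE expr0n eqxx.
apply/matrixP => i j; rewrite ord1 mxE.
by have /= := x0 i (mem_index_enum i); rewrite sqrf_eq0 => /eqP.
Qed.

Lemma enormZ_sqr (a : R) x : enorm (a *: x) ^+ 2 = a ^+ 2 * enorm x ^+ 2.
Proof. by rewrite !enorm_sqr [_^T]linearZ /= -scalemxAl -scalemxAr !mxE mulrA. Qed.

Lemma posdefmx_unit E : posdefmx E -> E \in unitmx.
Proof.
move=> [_ Epos]; rewrite -row_free_unit -kermx_eq0.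
apply/rowV0P => v /sub_kermxP vE0; apply/eqP; apply: contraT => v_neq0.
have := Epos v^T; rewrite trmx_eq0 trmxK vE0 mul0mx mxE ltxx.
by move=> /(_ v_neq0).
Qed.

Lemma exists_orthogonal z : (2 <= n)%N ->
  exists2 w : 'cV[R]_n, w != 0 & (w^T *m z) 0 0 = 0.
Proof.
move=> n2; have : kermx z != 0.
  rewrite -mxrank_eq0 mxrank_ker subn_eq0 -ltnNge.
  by rewrite (leq_ltn_trans (rank_leq_col z)).
case/rowV0Pn => v /sub_kermxP vz0 v_neq0.
by exists v^T; rewrite ?trmx_eq0 // trmxK vz0 mxE.
Qed.

Lemma enorm_comb (a b : R) z w : (w^T *m z) 0 0 = 0 ->
  enorm (a *: z + b *: w) ^+ 2 = a ^+ 2 * enorm z ^+ 2 + b ^+ 2 * enorm w ^+ 2.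
Proof.
move=> wz0; have zw0 : (z^T *m w) 0 0 = 0 by rewrite dotC.
rewrite !enorm_sqr [_^T]linearD /= ![(_ *: _)^T]linearZ /= mulmxDl !mulmxDr.
rewrite -!scalemxAl -!scalemxAr.
move: wz0 zw0; do 4 move: (_ *m _) => ?; rewrite !mxE => -> ->; ring.
Qed.

(** In the coordinates [y = E (x - c)] the cone consists of the vectors making
    the angle [theta] with the axis [z = E v]; rotating [z] by this angle
    towards an orthogonal vector yields one of them. *)
Lemma cone_nonapex c v (theta : R) E : (2 <= n)%N -> posdefmx E ->
  E *m v != 0 -> exists p, (cone c v theta E `\ c) p.
Proof.
move=> n2 Epos z_neq0; have Eunit := posdefmx_unit E Epos.
set z := E *m v in z_neq0 *.
have [w w_neq0 wz0] := exists_orthogonal z n2.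
(* The two orthogonal components are scaled so that the hypotenuse is
   [enorm z * enorm w] and no normalization is needed. *)
pose y := (cos theta * enorm w) *: z + (sin theta * enorm z) *: w.
have zP : 0 < enorm z by rewrite enorm_gt0.
have wP : 0 < enorm w by rewrite enorm_gt0.
have yE : enorm y = enorm z * enorm w.
  apply: (pexpIrn (n := 2)) => //; rewrite ?nnegrE ?mulr_ge0 ?enorm_ge0 //.
  rewrite enorm_comb // -[RHS]mulr1 -(cos2Dsin2 theta); ring.
have y_neq0 : y != 0 by rewrite -enorm_gt0 yE mulr_gt0.
have EpE : E *m (c + invmx E *m y - c) = y.
  by rewrite addrAC subrr add0r mulKVmx.
exists (c + invmx E *m y); split; last first.
  by move=> /= pc; move: y_neq0; rewrite -EpE pc subrr mulmx0 eqxx.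
have [ET _] := Epos.
have vEz : v^T *m E = z^T by rewrite trmx_mul ET.
rewrite /cone /= EpE -/z -!mulmxA EpE mulmxA vEz yE.
have zw0 : (z^T *m w) 0 0 = 0 by rewrite dotC.
rewrite mulmxDr -!scalemxAr.
move: (enorm_sqr z) zw0; do 2 move: (_ *m _) => ?; rewrite !mxE => <- ->.
ring.
Qed.

End Euclidean.

(** * Nonemptiness of the admissible ranges *)

Section Ranges.
Context {R : realType}.

Lemma powR_inv_sqrt_gt1 (a : R) : 0 < a < 1 -> 1 < a `^ (- 2^-1).
Proof.
move=> /andP[a0 a1]; rewrite powRN invf_gt1 ?powR_gt0 //.
have pow1 : 1 `^ 2^-1 = 1 :> R by rewrite powR1.
by rewrite -[ltRHS]pow1 gt0_ltr_powR ?nnegrE ?ltW ?invr_gt0.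
Qed.

Lemma powR_inv_sqrt_lt1 (a : R) : 1 < a -> 0 < a `^ (- 2^-1) < 1.
Proof.
move=> a1; have a0 : 0 < a by apply: lt_trans a1.
rewrite powR_gt0 //= powRN invf_lt1 ?powR_gt0 //.
have pow1 : 1 `^ 2^-1 = 1 :> R by rewrite powR1.
by rewrite -[ltLHS]pow1 gt0_ltr_powR ?nnegrE ?ltW ?invr_gt0.
Qed.

Lemma powR_inv_sqrtK (a : R) : 0 < a -> ((a `^ (- 2^-1)) ^+ 2)^-1 = a.
Proof.
move=> a0; rewrite powRN exprVn invrK -powR_mulrn ?powR_ge0 //.
by rewrite -powRrM mulVf ?pnatr_eq0 // powRr1 // ltW.
Qed.

Lemma midpoint_in (a b : R) : a < b -> (a + b) / 2 \in `]a, b[.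
Proof. by move=> ab; rewrite in_itv /= !midf_lt. Qed.

Context {n I : nat} (c : 'I_I -> 'cV[R]_n) (E : 'I_I -> 'M[R]_n).
Variables (i : 'I_I) (d : R).
Hypotheses (origin_free : 1 < enorm (E i *m c i)).
Hypothesis d_range : d \in `]delta_low c E i, 1[.

Let s := delta_low c E i ^+ 2.

Lemma delta_low_itv : 0 < delta_low c E i < 1.
Proof. exact: powR_inv_sqrt_lt1. Qed.

Lemma delta_low_ratio : s < s / d ^+ 2 < 1.
Proof.
have /andP[l0 l1] := delta_low_itv.
move: d_range; rewrite in_itv /= => /andP[ld d1].
have d0 : 0 < d by apply: lt_trans ld.
have s0 : 0 < s by rewrite exprn_gt0.
rewrite ltr_pdivrMr ?exprn_gt0 // mul1r (ltrXn2r _ (ltW l0) ld) andbT.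
by rewrite ltr_pdivlMr ?exprn_gt0 // gtr_pMr // exprn_ilt1 ?ltW.
Qed.

(** Replacing [s / d^2] by the smaller [s] turns the radicand into the square
    of [1 - 2 s]; hence it is positive. *)
Lemma mu_up_radicand_itv : 0 < 1 - 4 * s * (1 - s / d ^+ 2) < 1.
Proof.
have /andP[l0 l1] := delta_low_itv.
have s0 : 0 < s by rewrite exprn_gt0.
have := delta_low_ratio; move: (s / _) => r /andP[sr r1].
have sq : 0 <= (1 - 2 * s) ^+ 2 by exact: sqr_ge0.
by apply/andP; split; nra.
Qed.

Lemma mu_up_gt1 : 1 < mu_up c E i d.
Proof. exact: powR_inv_sqrt_gt1 mu_up_radicand_itv. Qed.

(** The bound on [m] is equivalent to
    [(1 - 1 / m^2) / (4 s) < 1 - s / d^2], which keeps the argument of the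
    arccosine below [1]. *)
Lemma theta_up_gt0 (m : R) : m \in `]1, mu_up c E i d[ ->
  0 < theta_up c E i d m.
Proof.
rewrite in_itv /= => /andP[m1 mu].
have /andP[l0 l1] := delta_low_itv.
have s0 : 0 < s by rewrite exprn_gt0.
have m0 : 0 < m by apply: lt_trans m1.
have M0 : 0 < mu_up c E i d by apply: lt_trans mu.
have mi_lt : (m ^+ 2)^-1 < 1 by rewrite invf_lt1 ?exprn_gt0 // exprn_egt1.
have mi_gt : 1 - 4 * s * (1 - s / d ^+ 2) < (m ^+ 2)^-1.
  have /andP[rad0 _] := mu_up_radicand_itv.
  rewrite -[ltLHS]powR_inv_sqrtK // ltf_pV2 ?posrE ?exprn_gt0 //.
  by rewrite (ltrXn2r _ (ltW m0) mu).
have /andP[sr r1] := delta_low_ratio.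
have q0 : 0 < (4 * s)^-1 by rewrite invr_gt0 mulr_gt0.
have q_up : (4 * s)^-1 * (1 - (m ^+ 2)^-1) < 1 - s / d ^+ 2.
  by rewrite mulrC ltr_pdivrMr ?mulr_gt0 // mulrC; lra.
have q_low : 0 < (4 * s)^-1 * (1 - (m ^+ 2)^-1) by rewrite mulr_gt0 ?subr_gt0.
by rewrite /theta_up -/s acos_gt0 //; apply/andP; split; lra.
Qed.

End Ranges.

(** * Avoidance modes away from the obstacles *)

(** On the helmet the norm of [E i *m (x - c i)] is at most [1 / d], whereas on
    the shrunk free space it is at least [1 / eps]. *)
Lemma helmet_shrunk_disjoint {R : realType} {n I : nat}
    (c : 'I_I -> 'cV[R]_n) (E : 'I_I -> 'M[R]_n) (i : 'I_I) (eps d m : R) x :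
  0 < eps < d -> helmet c E i d m x -> ~ shrunk_free_space c E eps x.
Proof.
move=> /andP[eps0 eps_d] [[+ _] _] /(_ i Logic.I).
rewrite /ellipsoid_le /ellipsoid_ge /= -!scalemxAl !enormZ_sqr.
move: (_ (E i *m _) ^+ 2) (sqr_ge0 (enorm (E i *m (x - c i)))) => N N0 dN epsN.
have sq_lt : eps ^+ 2 < d ^+ 2 by rewrite (ltrXn2r _ (ltW eps0) eps_d).
by nra.
Qed.

Theorem proposition1 (R : realType) (n I : nat)
    (c : 'I_I -> 'cV[R]_n) (E : 'I_I -> 'M[R]_n) (k0 eps : R) :
  (2 <= n)%N ->
  (forall i, posdefmx (E i)) ->
  trivIset setT (obstacle c E) ->
  (forall i, 1 < enorm (E i *m c i)) ->
  0 < k0 ->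
  0 < eps < 1 ->
  exists P : controller_params R n I,
    [/\ admissible c E P,
        gain_0 P = k0
      & forall (x : 'cV[R]_n) (i : 'I_I) (m : mode),
          flow_set c E P (x, i, m) -> shrunk_free_space c E eps x ->
          kappa c E P x i m = - (k0 *: x)].
Proof.
move=> n2 Epos _ origin_free k0_gt0 /andP[eps0 eps1].
(* Each open range is nonempty, and its midpoint is taken; only the lower end
   of the range of [d i] is raised, to [eps] if necessary. *)
pose d i := (Num.max eps (delta_low c E i) + 1) / 2.
have d_range i : d i \in `]Num.max eps (delta_low c E i), 1[.
  apply: midpoint_in; rewrite gt_max eps1.
  by have /andP[] := delta_low_itv c E i (origin_free i).
have dl i : d i \in `]delta_low c E i, 1[.
  by have := d_range i; rewrite !in_itv /= gt_max -andbA => /and3P[_ -> ->].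
have eps_d i : 0 < eps < d i.
  by have := d_range i; rewrite in_itv /= gt_max eps0 -andbA => /and3P[->].
pose e i := (d i + 1) / 2.
pose mu i := (1 + mu_up c E i (d i)) / 2.
have mu_range i : mu i \in `]1, mu_up c E i (d i)[.
  by apply: midpoint_in; apply: mu_up_gt1.
pose nu i := (1 + mu i) / 2.
pose th i := (0 + theta_up c E i (d i) (mu i)) / 2.
have th_range i : th i \in `]0, theta_up c E i (d i) (mu i)[.
  by apply: midpoint_in; apply: theta_up_gt0.
pose psb i := (0 + th i) / 2.
have psb_range i : psb i \in `]0, th i[.
  by apply: midpoint_in; have := th_range i; rewrite in_itv => /andP[].
pose ps i := (0 + psb i) / 2.
have /choice[p p_cone] i :
    exists p, (cone (c i) (- c i) (th i) (E i) `\ c i) p.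
  apply: cone_nonapex => //.
  by rewrite mulmxN oppr_eq0 -enorm_gt0 (lt_trans ltr01).
exists (ControllerParams 1 k0 1 d e mu nu th psb ps p); split=> //.
  split=> // i; split.
    split; [exact: dl| |exact: mu_range|]; apply: midpoint_in.
      by have := dl i; rewrite in_itv => /andP[].
    by have := mu_range i; rewrite in_itv => /andP[].
  split; [exact: th_range|exact: psb_range| |exact: p_cone].
  by apply: midpoint_in; have := psb_range i; rewrite in_itv => /andP[].
move=> x i m [m' _ [/= flow ->]] x_free.
by case: m' flow => //= -[j _ [/= [[/helmet_shrunk_disjoint hd _] _] _]];
  case: (hd _ (eps_d j)).
Qed.
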